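(* The following problem (Shortest Directed Tree Reconfiguration) can be solved in polynomial time when the input trees $T^s$ and $T^g$ are directed spanning trees of $G$: given a directed graph $G=(V,A)$, two directed trees $T^s$ and $T^g$ in $G$ with the same number of arcs, and an integer $\ell$, decide whether there is a sequence $\langle T_0, T_1, \ldots, T_{\ell'}\rangle$ with $\ell'\le \ell$ of directed trees in $G$ such that $T_0=T^s$, $T_{\ell'}=T^g$ and $|A(T_i)\setminus A(T_{i+1})| = |A(T_{i+1})\setminus A(T_i)| = 1$ for all $0\le i<\ell'$.
   Context: A directed tree is a directed graph $T$ whose underlying undirected graph is a tree and in which every vertex except one vertex $r$ has in-degree exactly $1$; $r$ is the root. A directed spanning tree of $G$ is a subgraph of $G$ that is a directed tree containing all vertices of $G$. *)

(* Defs.v *)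
From mathcomp Require Import all_boot all_order all_algebra.

Set Implicit Arguments.
Unset Strict Implicit.
Unset Printing Implicit Defensive.

(** * Random access machines

    The registers [R_0, R_1, ...] hold arbitrary natural numbers and are
    initially [0]. The input is a read-only bit string with random access.
    Every instruction costs one unit of time; since addition and truncated
    subtraction are the only arithmetic, the longest register grows by at most one
    bit per step (beyond the constants of the program), so that running times are
    polynomially related to those of Turing machines. *)

Inductive instr : Type :=
| Iconst of nat & nat      (* Iconst d c   : R_d := c *)
| Iadd of nat & nat & nat  (* Iadd d i j   : R_d := R_i + R_j *)
| Isub of nat & nat & nat  (* Isub d i j   : R_d := R_i - R_j, truncated *)
| Iload of nat & nat       (* Iload d i    : R_d := R_(R_i) *)
| Istore of nat & nat      (* Istore i j   : R_(R_i) := R_j *)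
| Iread of nat & nat       (* Iread d i    : R_d := input bit number R_i,
                                            or 2 beyond the end of the input *)
| Ijump of nat             (* Ijump l      : go to instruction l *)
| Ijzero of nat & nat      (* Ijzero i l   : if R_i = 0, go to instruction l *)
| Ihalt of bool.           (* Ihalt b      : stop and answer b *)

Definition program := seq instr.

Definition memory := nat -> nat.

Definition upd (m : memory) (d v : nat) : memory :=
  fun a => if a == d then v else m a.

Definition input_bit (x : seq bool) (i : nat) : nat :=
  nth 2 (map nat_of_bool x) i.

(* [run P x t pc m] is the answer of [P] on input [x] from instruction [pc] and
   memory [m] if it halts after executing at most [t] instructions, and [None]
   otherwise. Running past the end of the program means rejecting. *)
Fixpoint run (P : program) (x : seq bool) (t pc : nat) (m : memory)
    : option bool :=
  if t isn't t'.+1 then None else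
  match nth (Ihalt false) P pc with
  | Iconst d c => run P x t' pc.+1 (upd m d c)
  | Iadd d i j => run P x t' pc.+1 (upd m d (m i + m j))
  | Isub d i j => run P x t' pc.+1 (upd m d (m i - m j))
  | Iload d i  => run P x t' pc.+1 (upd m d (m (m i)))
  | Istore i j => run P x t' pc.+1 (upd m (m i) (m j))
  | Iread d i  => run P x t' pc.+1 (upd m d (input_bit x (m i)))
  | Ijump l    => run P x t' l m
  | Ijzero i l => run P x t' (if m i == 0 then l else pc.+1) m
  | Ihalt b    => Some b
  end.

Definition answers_within (P : program) (x : seq bool) (t : nat) (b : bool)
    : Prop :=
  run P x t 0 (fun=> 0) = Some b.

(* The decision problem [yes], restricted to the instances satisfying
   [promise], is solvable in time polynomial in the length of the encoding. *)
Definition poly_time_solvable (I : Type) (encode : I -> seq bool)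
    (promise yes : I -> Prop) : Prop :=
  exists (P : program) (p : {poly nat}),
    forall x : I, promise x ->
      exists b : bool,
        answers_within P (encode x) p.[size (encode x)]%R b /\ (b <-> yes x).

(** * Directed trees *)

Section DirectedTrees.
Variable V : finType.

Record digraph : Type := Digraph { verts : {set V}; arcs : {set V * V} }.

Implicit Types (G T : digraph) (u v r : V).

Definition wf_digraph G : Prop :=
  forall u v, (u, v) \in arcs G -> u \in verts G /\ v \in verts G.

Definition subdigraph T G : Prop :=
  [/\ wf_digraph T, verts T \subset verts G & arcs T \subset arcs G].

Definition adjacent G : rel V :=
  fun u v => ((u, v) \in arcs G) || ((v, u) \in arcs G).

(* The underlying undirected graph has one edge for each arc, so a loop or a
   pair of opposite arcs is a cycle in it. These two kinds of cycles are not
   visible on the simple relation [adjacent] and are excluded separately. *)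
Definition underlying_acyclic G : Prop :=
  (forall u v, (u, v) \in arcs G -> (v, u) \notin arcs G) /\
  (forall c : seq V, ucycle (adjacent G) c -> size c <= 2).

Definition underlying_connected G : Prop :=
  forall u v, u \in verts G -> v \in verts G -> connect (adjacent G) u v.

Definition underlying_tree G : Prop :=
  [/\ verts G != set0, underlying_connected G & underlying_acyclic G].

Definition in_degree G v : nat := #|[set u | (u, v) \in arcs G]|.

Definition directed_tree T : Prop :=
  [/\ wf_digraph T, underlying_tree T &
      exists2 r, r \in verts T &
        forall v, v \in verts T -> (in_degree T v == 1) = (v != r)].

Definition directed_tree_in G T : Prop := subdigraph T G /\ directed_tree T.

Definition directed_spanning_tree G T : Prop :=
  directed_tree_in G T /\ verts T = verts G.

Definition reconfiguration_step T T' : Prop :=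
  #|arcs T :\: arcs T'| = 1 /\ #|arcs T' :\: arcs T| = 1.

(* [T 0, ..., T l] is the sequence; the values of [T] beyond [l] are junk. *)
Definition reconfiguration_sequence G (Ts Tg : digraph) (l : nat)
    (T : nat -> digraph) : Prop :=
  [/\ T 0 = Ts, T l = Tg,
      forall i, i <= l -> directed_tree_in G (T i) &
      forall i, i < l -> reconfiguration_step (T i) (T i.+1)].

End DirectedTrees.

(** * Shortest Directed Tree Reconfiguration *)

Record instance : Type := Instance {
  nverts : nat;
  graph_arcs : {set 'I_nverts * 'I_nverts};
  source : digraph 'I_nverts;
  target : digraph 'I_nverts;
  max_steps : int
}.

Definition graph (I : instance) : digraph 'I_(nverts I) :=
  Digraph [set: 'I_(nverts I)] (graph_arcs I).

Definition valid_instance (I : instance) : Prop :=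
  [/\ directed_tree_in (graph I) (source I),
      directed_tree_in (graph I) (target I) &
      #|arcs (source I)| = #|arcs (target I)|].

Definition spanning_instance (I : instance) : Prop :=
  directed_spanning_tree (graph I) (source I) /\
  directed_spanning_tree (graph I) (target I).

Definition shortest_directed_tree_reconfiguration (I : instance) : Prop :=
  exists l : nat, (l%:Z <= max_steps I)%R /\
    exists T : nat -> digraph 'I_(nverts I),
      reconfiguration_sequence (graph I) (source I) (target I) l T.

(** ** Encoding of instances as bit strings *)

(* Binary digits, least significant first, without leading zeros. *)
Definition binary (m : nat) : seq bool :=
  mkseq (fun i => odd (m %/ 2 ^ i)) (up_log 2 m.+1).

Definition encode_int (z : int) : seq bool := (z < 0)%R :: binary `|z|%N.

Definition encode_verts n (S : {set 'I_n}) : seq bool :=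
  [seq i \in S | i <- enum 'I_n].

(* The adjacency matrix, row by row. *)
Definition encode_arcs n (A : {set 'I_n * 'I_n}) : seq bool :=
  [seq (i, j) \in A | i <- enum 'I_n, j <- enum 'I_n].

Definition encode_digraph n (T : digraph 'I_n) : seq bool :=
  encode_verts (verts T) ++ encode_arcs (arcs T).

(* The number of vertices is in unary, terminated by [false]; all the blocks
   that follow have a length determined by it, except the last one. *)
Definition encode_instance (I : instance) : seq bool :=
  nseq (nverts I) true ++ false :: encode_arcs (graph_arcs I)
    ++ encode_digraph (source I) ++ encode_digraph (target I)
    ++ encode_int (max_steps I).

(* Main.v *)
Require Import Defs.
From mathcomp Require Import all_boot all_order all_algebra zify.

Set Implicit Arguments.
Unset Strict Implicit.
Unset Printing Implicit Defensive.

(** The least number of steps between two directed spanning trees S and T is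
    |A(S) \ A(T)|. A step decreases the number of arcs outside T by at most one.
    Conversely, if S <> T, some exchange replaces an arc of S outside T by an arc
    of T outside S. If the roots differ, add the arc (x, r) of T entering the root
    r of S; it closes a cycle of S, which contains an arc outside T because T is
    acyclic, and that arc is removed. If the roots agree, take a vertex y that is
    highest in T among those whose in-arcs differ, and exchange its in-arcs. So it
    suffices to count the differences between two adjacency matrices and to
    compare the result with the bound. *)

(** * Reachability, acyclic relations and arborescences *)

Lemma connect_ind_r (V : finType) (e : rel V) (P : V -> Prop) (x : V) :
  P x -> (forall u v, connect e x u -> P u -> e u v -> P v) ->
  forall y, connect e x y -> P y.
Proof.
move=> Px Pe y /connectP[p ep ->].
elim/last_ind: p ep => [//|p z IHp]; rewrite rcons_path last_rcons => /andP[ep ez].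
by apply: Pe ez; [apply/connectP; exists p | apply: IHp].
Qed.

Lemma connect_last_arc (V : finType) (e : rel V) (x y : V) :
  connect e x y -> x = y \/ exists2 z, connect e x z & e z y.
Proof.
move: y; apply: connect_ind_r; first by left.
by move=> u v xu _ uv; right; exists u.
Qed.

Definition acyclic (V : finType) (e : rel V) : Prop :=
  forall u v, e u v -> ~~ connect e v u.

(** The number of ancestors replaces the depth: along the arcs of an acyclic relation it strictly
    increases. *)
Definition rank (V : finType) (e : rel V) (v : V) : nat :=
  #|[set w | connect e w v]|.

Lemma rank_lt (V : finType) (e : rel V) (u v : V) :
  acyclic e -> e u v -> rank e u < rank e v.
Proof.
move=> acy uv; apply/proper_card/properP; split.
  apply/subsetP=> w; rewrite !inE => wu; exact: connect_trans wu (connect1 uv).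
by exists v; rewrite inE ?connect0 // acy.
Qed.

Definition arc_rel (V : finType) (A : {set V * V}) : rel V :=
  fun u v => (u, v) \in A.

Record arborescence (V : finType) (A : {set V * V}) (r : V) : Prop :=
  Arborescence {
    arb_in_uniq : forall u u' v, (u, v) \in A -> (u', v) \in A -> u = u';
    arb_root : forall u, (u, r) \notin A;
    arb_reach : forall v, connect (arc_rel A) r v }.

(** Induction along a path from the root: a cycle through [v] enters [v] by its only in-arc, so it
    passes through the parent of [v] as well, whereas nothing enters the root. *)
Lemma arb_acyclic (V : finType) (A : {set V * V}) (r : V) :
  arborescence A r -> acyclic (arc_rel A).
Proof.
case=> uniA rootA reachA.
suff nocyc v : ~ exists2 u, arc_rel A u v & connect (arc_rel A) v u.
  by move=> u v uv; apply/negP=> vu; case: (nocyc v); exists u.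
have := reachA v; move: v; apply: connect_ind_r => [[u]|u v _ IHu uv [u1 u1v]].
  by rewrite /arc_rel (negPf (rootA u)).
rewrite (uniA _ _ _ u1v uv) => vu; apply: IHu.
case: (connect_last_arc vu) => [vEu|[w vw wu]].
  by exists u => //; rewrite -{2}vEu.
by exists w => //; apply: connect_trans vw; apply: connect1.
Qed.

Lemma arb_parent (V : finType) (A : {set V * V}) (r v : V) :
  arborescence A r -> v != r -> exists u, (u, v) \in A.
Proof.
case=> _ _ reachA vr; case: (connect_last_arc (reachA v)) => [rv|[u _ uv]].
  by rewrite rv eqxx in vr.
by exists u.
Qed.

(** * Directed spanning trees as arborescences *)

Lemma tree_arborescence (V : finType) (T : digraph V) :
  directed_tree T -> verts T = [set: V] -> exists r, arborescence (arcs T) r.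
Proof.
move=> [_ [_ _ [asymT cycT]] [r _ degT]] vT.
have {}degT v : (in_degree T v == 1) = (v != r) by apply: degT; rewrite vT inE.
have acy : acyclic (arc_rel (arcs T)).
  (* A shortest way back from [v] to [u], closed by [(u, v)], is an undirected cycle; [cycT] leaves
     only a loop or two opposite arcs, both excluded by [asymT]. *)
  move=> u v uv; apply/negP=> /connectP[p0 p0P].
  case/shortenP: p0P => p vp uniq_p _ {p0} uE; rewrite uE in uv.
  have : size (v :: p) <= 2.
    apply: cycT; rewrite /ucycle; apply/andP; split=> //=.
    rewrite rcons_path; apply/andP; split; last by apply/orP; left.
    by apply: sub_path vp => x y xy; apply/orP; left.
  case: p vp {uniq_p} uE uv => [|w [|? ?]] //= => [_ _ vv|].
    by have := asymT _ _ vv; rewrite [_ \in _]vv.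
  by rewrite andbT => vw _ /asymT; rewrite [(v, w) \in _]vw.
have parent v : v != r -> exists u, (u, v) \in arcs T.
  rewrite -degT => /cards1P[u uE]; exists u.
  by have := set11 u; rewrite -uE inE.
have rootT u : (u, r) \notin arcs T.
  (* The degree condition only says that the in-degree of [r] is not 1. A vertex of minimal rank has
     no in-arc, and by [parent] it must be [r]. *)
  have [v _ vmin] := arg_minnP (rank (arc_rel (arcs T))) (isT : xpredT r).
  have noin w : (w, v) \notin arcs T.
    by apply/negP=> /(rank_lt acy); rewrite ltnNge vmin.
  suff <- : v = r by [].
  by apply/eqP/contraT => /parent[w]; rewrite (negPf (noin w)).
exists r; split=> // [u u' v uv u'v|v].
  have vr : v != r by apply/eqP=> vr; move: (rootT u); rewrite -vr uv.
  have /cards1P[w wE] : in_degree T v == 1 by rewrite degT.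
  have : u \in [set w] by rewrite -wE inE.
  have : u' \in [set w] by rewrite -wE inE.
  by rewrite !inE => /eqP-> /eqP->.
(* Climbing from child to parent decreases the rank, so it ends at [r]. *)
have [n] := ubnP (rank (arc_rel (arcs T)) v).
elim: n => // n IHn in v *; rewrite ltnS => vn.
have [->|/parent[u uv]] := eqVneq v r; first exact: connect0.
apply: connect_trans (connect1 (uv : arc_rel _ u v)).
exact/IHn/(leq_trans _ vn)/rank_lt.
Qed.

Lemma arborescence_tree (V : finType) (A : {set V * V}) (r : V) :
  arborescence A r -> directed_tree (Digraph [set: V] A).
Proof.
move=> arbA; have [uniA rootA reachA] := arbA.
have acy := arb_acyclic arbA.
split; first by move=> u v _; rewrite !inE.
- split=> [|u v _ _|]; first by apply/set0Pn; exists r; rewrite inE.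
    have reach w : connect (adjacent (Digraph [set: V] A)) r w.
      by apply: connect_sub (reachA w) => x y xy; apply/connect1/orP; left.
    apply: connect_trans (reach v).
    rewrite (@sym_connect_sym _ (adjacent _)) //.
    by move=> x y; rewrite /adjacent orbC.
  split=> [u v /= uv|c /andP[]].
    by apply: contraTN (uv) => vu; apply: contraL (connect1 (vu : arc_rel A v u)); move/acy.
  move=> cyc_c uniq_c; rewrite leqNgt; apply/negP=> size_c.
  have [x0 x0c] : exists x, x \in c.
    by case: c size_c {cyc_c uniq_c} => // x; exists x; rewrite mem_head.
  (* Both neighbours on the cycle of a vertex of maximal rank are its parent. *)
  have [v vc vmax] := arg_maxnP (rank (arc_rel A)) x0c.
  have parent w : w \in c -> adjacent (Digraph [set: V] A) v w -> (w, v) \in A.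
    move=> wc /orP[vw|//]; have := rank_lt acy (vw : arc_rel A v w).
    by rewrite ltnNge; have := vmax w wc; rewrite /geq /= => ->.
  case: (rot_to vc) => i c' c'E.
  have mem_c w : w \in c' -> w \in c.
    by move=> wc'; rewrite -(mem_rot i) c'E inE wc' orbT.
  move: size_c uniq_c cyc_c; rewrite -(size_rot i) -(rot_uniq i) -(rot_cycle i) c'E.
  case: c' mem_c {c'E} => [|y c'] //; case/lastP: c' => [//|c' z] mem_c _ /=.
  rewrite rcons_path last_rcons => /and3P[_ yz _].
  case/and3P=> vy _ zv.
  have yA : (y, v) \in A by apply: parent vy; apply: mem_c; rewrite mem_head.
  have zA : (z, v) \in A.
    apply: parent; last by rewrite /adjacent orbC.
    by apply: mem_c; rewrite inE mem_rcons mem_head orbT.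
  by rewrite (uniA _ _ _ yA zA) mem_rcons mem_head in yz.
exists r; rewrite ?inE // => v _; apply/idP/idP.
  apply: contraTneq => ->; rewrite /in_degree /=.
  suff -> : [set u | (u, r) \in A] = set0 by rewrite cards0.
  by apply/setP=> u; rewrite !inE (negPf (rootA u)).
move=> /(arb_parent arbA)[u uv]; apply/cards1P; exists u.
apply/setP=> w; rewrite !inE; apply/idP/eqP=> [wv|-> //]; exact: uniA wv uv.
Qed.

(** * Exchanging one arc of an arborescence *)

(** Removing [(u, v)] cuts off the subtree of [v], which contains [x]; the arc [(x, r)] then hangs
    the rest of the tree below [x]. *)
Lemma arborescence_reroot (V : finType) (A : {set V * V}) (r u v x : V) :
  arborescence A r -> (u, v) \in A -> connect (arc_rel A) v x ->
  arborescence ((x, r) |: (A :\ (u, v))) v.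
Proof.
move=> arbA uv vx; have [uniA rootA reachA] := arbA.
have vr : v != r by apply: contraTneq uv => ->; apply: rootA.
have keep w w' : w' != v -> arc_rel A w w' ->
    arc_rel ((x, r) |: (A :\ (u, v))) w w'.
  move=> w'v ww'.
  by rewrite /arc_rel !inE [_ \in A]ww' andbT xpair_eqE negb_and w'v !orbT.
have reach_x : connect (arc_rel ((x, r) |: (A :\ (u, v)))) v x.
  suff reach w : connect (arc_rel A) v w ->
      connect (arc_rel ((x, r) |: (A :\ (u, v)))) v w by exact: reach.
  move: w; apply: connect_ind_r => // w w' vw vw_ ww'.
  apply: connect_trans vw_ (connect1 (keep _ _ _ ww')).
  by apply: contraTneq vw => w'v; apply: (arb_acyclic arbA); rewrite -w'v.
split.
- move=> w w' z; rewrite !inE !xpair_eqE.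
  have [->|zr] := eqVneq z r; rewrite ?andbT ?andbF ?(negPf (rootA _)) /= ?andbF ?orbF.
    by move=> /eqP-> /eqP->.
  by move=> /andP[_ wz] /andP[_]; apply: uniA wz.
- move=> w; rewrite !inE !xpair_eqE (negPf vr) andbF /=.
  by apply/negP=> /andP[nwu wv]; rewrite (uniA _ _ _ wv uv) !eqxx in nwu.
- move=> w; have := reachA w; move: w; apply: connect_ind_r.
    by apply: connect_trans reach_x (connect1 _); rewrite /arc_rel !inE eqxx.
  move=> w w' _ vw ww'; have [->//|w'v] := eqVneq w' v.
  exact: connect_trans vw (connect1 (keep _ _ w'v ww')).
Qed.

(** Since [x] lies outside the subtree of [v], its path from [r] avoids [v] and survives, so the
    subtree can be moved below [x]. *)
Lemma arborescence_reattach (V : finType) (A : {set V * V}) (r u v x : V) :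
  arborescence A r -> (u, v) \in A -> ~~ connect (arc_rel A) v x ->
  arborescence ((x, v) |: (A :\ (u, v))) r.
Proof.
move=> arbA uv vx; have [uniA rootA reachA] := arbA.
have vr : r != v by apply: contraTneq uv => <-; apply: rootA.
have keep w w' : w' != v -> arc_rel A w w' ->
    arc_rel ((x, v) |: (A :\ (u, v))) w w'.
  move=> w'v ww'.
  by rewrite /arc_rel !inE [_ \in A]ww' andbT xpair_eqE negb_and w'v !orbT.
have reach_nondesc w :
    ~~ connect (arc_rel A) v w -> connect (arc_rel ((x, v) |: (A :\ (u, v)))) r w.
  have := reachA w; move: w; apply: connect_ind_r => // w w' _ IHw ww' vw'.
  have vw : ~~ connect (arc_rel A) v w.
    by apply: contra vw' => vw; apply: connect_trans vw (connect1 ww').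
  apply: connect_trans (IHw vw) (connect1 (keep _ _ _ ww')).
  by apply: contraNneq vw' => ->.
have reach_v : connect (arc_rel ((x, v) |: (A :\ (u, v)))) r v.
  apply: connect_trans (reach_nondesc _ vx) (connect1 _).
  by rewrite /arc_rel !inE eqxx.
split.
- move=> w w' z; rewrite !inE !xpair_eqE.
  have [->|zv] := eqVneq z v; rewrite ?andbT ?andbF /=.
    have old y : (y != u) && ((y, v) \in A) = false.
      by apply/negP=> /andP[yu yv]; rewrite (uniA _ _ _ yv uv) eqxx in yu.
    by rewrite !old !orbF => /eqP-> /eqP->.
  by move=> wz w'z; apply: uniA wz w'z.
- by move=> w; rewrite !inE !xpair_eqE (negPf vr) andbF /= negb_and rootA orbT.
- move=> w; have := reachA w; move: w; apply: connect_ind_r => // w w' _ rw ww'.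
  have [->//|w'v] := eqVneq w' v.
  exact: connect_trans rw (connect1 (keep _ _ w'v ww')).
Qed.

Lemma arborescence_exchange (V : finType) (A B : {set V * V}) (r s : V) :
  arborescence A r -> arborescence B s -> A != B ->
  exists a b r', [/\ a \in A :\: B, b \in B :\: A &
                     arborescence (b |: (A :\ a)) r'].
Proof.
move=> arbA arbB AB; have [uniA rootA reachA] := arbA.
have [uniB rootB reachB] := arbB.
have acyB := arb_acyclic arbB.
have [srE|rs] := eqVneq s r; last first.
  have [x xr] : exists x, (x, r) \in B by apply: (arb_parent arbB); rewrite eq_sym.
  have [/existsP[u /existsP[v /and3P[uvA uvB vx]]]|/existsPn noarc] :=
    boolP [exists u, exists v,
      [&& (u, v) \in A, (u, v) \notin B & connect (arc_rel A) v x]].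
    exists (u, v), (x, r), v.
    rewrite !inE uvA uvB xr rootA; split=> //; exact: arborescence_reroot.
  (* Otherwise the path of [A] from [r] to [x] lies in [B] and closes a cycle of [B] with
     [(x, r)]. *)
  suff: connect (arc_rel B) r x by rewrite (negPf (acyB x r xr)).
  suff path_in_B w : connect (arc_rel A) w x -> connect (arc_rel B) r w.
    exact: path_in_B.
  have := reachA w; move: w; apply: connect_ind_r => // u v _ IHu uv vx.
  apply: connect_trans (IHu (connect_trans (connect1 uv) vx)) (connect1 _).
  have /existsPn/(_ v) := noarc u.
  by rewrite vx andbT [(u, v) \in A]uv /= negbK.
rewrite srE in arbB rootB; pose P y := [exists x, (x, y) \in B :\: A].
have [y0 y0P] : exists y, P y.
  have: ~~ (B \subset A) || ~~ (A \subset B).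
    by rewrite -negb_and -eqEsubset eq_sym.
  case/orP=> /subsetPn[[x y] xy1 xy2].
    by exists y; apply/existsP; exists x; rewrite inE xy1 xy2.
  have yr : y != r by apply: contraTneq xy1 => ->; apply: rootA.
  have [z zy] := arb_parent arbB yr.
  exists y; apply/existsP; exists z; rewrite inE zy andbT.
  by apply: contra xy2 => zyA; rewrite (uniA _ _ _ xy1 zyA).
have [y /existsP[x]] := @arg_minnP _ y0 P (rank (arc_rel B)) y0P.
rewrite inE => /andP[xyA xyB] ymin.
have yr : y != r by apply: contraTneq xyB => ->; apply: rootB.
have [u uy] := arb_parent arbA yr.
have uyB : (u, y) \notin B.
  by apply: contra xyA => uyB; rewrite (uniB _ _ _ xyB uyB).
exists (u, y), (x, y), r; rewrite !inE uy uyB xyB xyA; split=> //.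
apply: arborescence_reattach => //; apply/negP=> yx.
(* Going down from [y] in [A], the [B]-rank never falls below that of [y]: if it first did at [w],
   minimality of [y] would put the [B]-parent of [w] in [A], making it the previous vertex, of even
   smaller rank. But [x] is the [B]-parent of [y]. *)
have : rank (arc_rel B) y <= rank (arc_rel B) x.
  move: x yx {xyA xyB}; apply: connect_ind_r => // v w _ yv vw.
  rewrite leqNgt; apply/negP=> wy.
  have wr : w != r by apply: contraTneq vw => ->; apply: rootA.
  have [v' v'w] := arb_parent arbB wr.
  have v'wA : (v', w) \in A.
    apply: contraLR wy => v'wA; rewrite -leqNgt; apply: ymin.
    by apply/existsP; exists v'; rewrite inE v'w v'wA.
  have := rank_lt acyB (v'w : arc_rel B v' w).
  by rewrite (uniA _ _ _ v'wA vw) ltnNge (leq_trans (ltnW wy)).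
by rewrite leqNgt (rank_lt acyB).
Qed.

Lemma exchange_diff (T : finType) (A B : {set T}) (a b : T) :
  a \in A :\: B -> b \in B :\: A ->
  [/\ #|A :\: (b |: (A :\ a))| = 1, #|(b |: (A :\ a)) :\: A| = 1 &
      (b |: (A :\ a)) :\: B = (A :\: B) :\ a].
Proof.
rewrite !inE => /andP[aB aA] /andP[bA bB].
have ab : a != b by apply: contraNneq bA => <-.
split.
- rewrite (_ : _ :\: _ = [set a]) ?cards1 //; apply/setP=> x; rewrite !inE.
  have [->|xa] := eqVneq x a; first by rewrite (negPf ab) aA.
  by case: (x \in A); rewrite ?andbF // orbT.
- rewrite (_ : _ :\: _ = [set b]) ?cards1 //; apply/setP=> x; rewrite !inE.
  have [->|xb] := eqVneq x b; first by rewrite bA.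
  by case: (x \in A); rewrite ?andbF.
- apply/setP=> x; rewrite !inE; have [->|xb] := eqVneq x b.
    by rewrite bB (negPf bA) !andbF.
  by rewrite /= andbCA.
Qed.

(** * Length of a shortest reconfiguration sequence *)

Lemma arborescence_reconfiguration (V : finType) (A B : {set V * V}) (r s : V) :
  arborescence A r -> arborescence B s ->
  exists F : nat -> {set V * V},
    [/\ F 0 = A, F #|A :\: B| = B,
        forall i, i <= #|A :\: B| ->
          F i \subset A :|: B /\ exists r', arborescence (F i) r' &
        forall i, i < #|A :\: B| ->
          #|F i :\: F i.+1| = 1 /\ #|F i.+1 :\: F i| = 1].
Proof.
move=> + arbB; have [d] := ubnP #|A :\: B|.
elim: d => // d IHd in A r *; rewrite ltnS => ABd arbA.
have [AB|AB] := eqVneq A B.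
  exists (fun=> A); rewrite AB setDv cards0; split=> // i.
  by rewrite setUid -AB; split=> //; exists r.
have [a [b [r' [aAB bBA arbA']]]] := arborescence_exchange arbA arbB AB.
have [AA' A'A A'B] := exchange_diff aAB bBA.
have cardA : #|A :\: B| = #|(b |: (A :\ a)) :\: B|.+1.
  by rewrite A'B (cardsD1 a) aAB.
have [|F [F0 Fl arbF stepF]] := IHd _ _ _ arbA'; first by rewrite -cardA.
exists (fun i => if i is j.+1 then F j else A); rewrite cardA; split=> //.
  case=> [_|i /arbF[subF]]; first by split; [apply: subsetUl | exists r].
  split=> //; apply: subset_trans subF _; rewrite !subUset subsetUr andbT.
  rewrite sub1set inE; move: bBA; rewrite inE => /andP[_ ->]; rewrite orbT /=.
  by apply: subset_trans (subsetUl _ _); apply: subD1set.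
by case=> [_|i /stepF //]; rewrite F0.
Qed.

Lemma reconfiguration_length (V : finType) (G Ts Tg : digraph V) (l : nat)
    (T : nat -> digraph V) :
  reconfiguration_sequence G Ts Tg l T -> #|arcs Ts :\: arcs Tg| <= l.
Proof.
case=> <- <- _ stepT.
suff : forall i, i <= l -> #|arcs (T 0) :\: arcs (T i)| <= i by apply.
elim=> [|i IHi] il; first by rewrite setDv cards0.
apply: (@leq_trans #|(arcs (T 0) :\: arcs (T i)) :|: (arcs (T i) :\: arcs (T i.+1))|).
  apply/subset_leq_card/subsetP=> x; rewrite !inE => /andP[-> ->].
  by rewrite !andbT orNb.
apply: leq_trans (leq_card_setU _ _) _.
by rewrite (stepT i il).1 addn1 ltnS IHi // ltnW.
Qed.

Lemma shortest_reconfigurationE (I : instance) :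
  spanning_instance I ->
  (shortest_directed_tree_reconfiguration I <->
   (#|arcs (source I) :\: arcs (target I)|%:Z <= max_steps I)%R).
Proof.
move=> [[[[_ _ subs] trees] spans] [[[_ _ subg] treeg] spang]].
split=> [[l [lI [T /reconfiguration_length Tl]]]|dI].
  by apply: Order.POrderTheory.le_trans lI; rewrite lez_nat.
have [r arbs] := tree_arborescence trees spans.
have [s arbg] := tree_arborescence treeg spang.
have [F [F0 Fl arbF stepF]] := arborescence_reconfiguration arbs arbg.
exists #|arcs (source I) :\: arcs (target I)|; split=> //.
exists (fun i => Digraph [set: 'I_(nverts I)] (F i)); split=> //.
- by rewrite F0 -[[set: _]]spans; case: (source I).
- by rewrite Fl -[[set: _]]spang; case: (target I).
move=> i /arbF[subF [r' arbFi]]; split; last exact: arborescence_tree arbFi.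
split=> //=.
by apply: subset_trans subF _; rewrite subUset subs subg.
Qed.

(** * Execution and correctness of the machine program *)

Arguments run : simpl never.

Lemma runS (P : program) (x : seq bool) (t pc : nat) (m : memory) :
  run P x t.+1 pc m =
  match nth (Ihalt false) P pc with
  | Iconst d c => run P x t pc.+1 (upd m d c)
  | Iadd d i j => run P x t pc.+1 (upd m d (m i + m j))
  | Isub d i j => run P x t pc.+1 (upd m d (m i - m j))
  | Iload d i  => run P x t pc.+1 (upd m d (m (m i)))
  | Istore i j => run P x t pc.+1 (upd m (m i) (m j))
  | Iread d i  => run P x t pc.+1 (upd m d (input_bit x (m i)))
  | Ijump l    => run P x t l m
  | Ijzero i l => run P x t (if m i == 0 then l else pc.+1) m
  | Ihalt b    => Some b
  end.
Proof. by []. Qed.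

Lemma run_monotone (P : program) (x : seq bool) (b : bool) (t t' pc : nat)
    (m : memory) :
  t <= t' -> run P x t pc m = Some b -> run P x t' pc m = Some b.
Proof.
elim: t t' pc m => [//|t IHt] [//|t'] pc m; rewrite ltnS => tt'.
rewrite !runS; case: (nth _ _ _) => * //; exact: IHt.
Qed.

Lemma input_bit_drop (x : seq bool) (i : nat) (b : bool) (s : seq bool) :
  drop i x = b :: s -> input_bit x i = b /\ drop i.+1 x = s.
Proof.
move=> dE; have ix : i < size x.
  by rewrite ltnNge; apply/negP=> /drop_oversize; rewrite dE.
move: dE; rewrite (drop_nth false ix) => -[<- <-].
by rewrite /input_bit (nth_map false).
Qed.

Lemma input_bit_end (x : seq bool) (i : nat) :
  drop i x = [::] -> input_bit x i = 2.
Proof.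
move=> /(congr1 size)/eqP; rewrite size_drop subn_eq0 => xi.
by rewrite /input_bit nth_default ?size_map.
Qed.

(* Register 0 holds 1, register 9 holds 0, and register 1 receives the number n
   of vertices; register 4 counts down from n ^ 2 while registers 5 and 6 scan
   the adjacency matrices of the two trees; register 7 counts the differences.
   Finally register 6 scans the digits of the bound, register 8 holds the
   current power of 2, and register 4 receives the bound. *)
Definition difference_program : program := [::
  (*  0 *) Iconst 0 1;
  (*  1 *) Iread 2 1;
  (*  2 *) Ijzero 2 5;
  (*  3 *) Iadd 1 1 0;
  (*  4 *) Ijump 1;
  (*  5 *) Iadd 3 1 9;
  (*  6 *) Ijzero 3 10;
  (*  7 *) Iadd 4 4 1;
  (*  8 *) Isub 3 3 0;
  (*  9 *) Ijump 6;
  (* 10 *) Iadd 5 1 1;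
  (* 11 *) Iadd 5 5 0;
  (* 12 *) Iadd 5 5 4;
  (* 13 *) Iadd 6 5 4;
  (* 14 *) Iadd 6 6 1;
  (* 15 *) Ijzero 4 24;
  (* 16 *) Iread 2 5;
  (* 17 *) Iread 3 6;
  (* 18 *) Isub 2 2 3;
  (* 19 *) Iadd 7 7 2;
  (* 20 *) Iadd 5 5 0;
  (* 21 *) Iadd 6 6 0;
  (* 22 *) Isub 4 4 0;
  (* 23 *) Ijump 15;
  (* 24 *) Iread 2 6;
  (* 25 *) Ijzero 2 27;
  (* 26 *) Ihalt false;
  (* 27 *) Iconst 8 1;
  (* 28 *) Iadd 6 6 0;
  (* 29 *) Iread 2 6;
  (* 30 *) Isub 3 2 0;
  (* 31 *) Ijzero 3 33;
  (* 32 *) Ijump 37;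
  (* 33 *) Ijzero 2 35;
  (* 34 *) Iadd 4 4 8;
  (* 35 *) Iadd 8 8 8;
  (* 36 *) Ijump 28;
  (* 37 *) Isub 7 7 4;
  (* 38 *) Ijzero 7 40;
  (* 39 *) Ihalt false;
  (* 40 *) Ihalt true].

Definition binary_value (s : seq bool) : nat :=
  foldr (fun (b : bool) v => b + v.*2) 0 s.

Lemma binaryK : cancel binary binary_value.
Proof.
move=> m; rewrite /binary; have : m.+1 <= 2 ^ up_log 2 m.+1 by apply: up_logP.
move: (up_log 2 m.+1) => k.
elim: k m => [[]//|k IHk] m mk; rewrite /mkseq /= expn0 divn1.
(* The digits of [m] after the lowest one are those of [m./2]. *)
rewrite (iotaDl 1 0) -map_comp (eq_map (g := fun i => odd (m./2 %/ 2 ^ i))).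
  rewrite -/(mkseq _ _) IHk ?odd_double_half //.
  by rewrite -divn2 ltn_divLR // -expnSr.
by move=> i /=; rewrite add1n expnS divnMA divn2.
Qed.

Lemma run_digits (x : seq bool) (m : memory) (s : seq bool) :
  m 0 = 1 -> drop (m 6).+1 x = s ->
  run difference_program x (8 * (size s).+1) 28 m =
    Some (m 7 <= m 4 + m 8 * binary_value s).
Proof.
elim: s m => [|b s IHs] m m0 ds; rewrite mulnS !addSn add0n.
  do 2 rewrite runS /upd /= ?m0 ?addn1.
  (* Past the end the machine reads 2, and [2 - 1] is nonzero, which leaves the loop; for a digit
     this truncated difference is 0. *)
  rewrite (input_bit_end ds); do 5 rewrite runS /upd /= ?m0.
  by rewrite !muln0 addn0 /leq; case: eqP => _; rewrite runS.
have [bE ds'] := input_bit_drop ds.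
do 2 rewrite runS /upd /= ?m0 ?addn1.
rewrite bE.
case: b {ds bE}; do 2 rewrite runS /upd /= ?m0.
  do 4 rewrite runS /upd /= ?m0.
  by rewrite IHs //=; congr (Some (_ <= _)); lia.
do 3 rewrite runS /upd /= ?m0.
(* A digit 0 skips the addition and takes 7 instructions instead of 8. *)
apply: run_monotone (leqnSn _) _.
by rewrite IHs //=; congr (Some (_ <= _)); lia.
Qed.

(** On bits, truncated subtraction is 1 only for [true] minus [false]; this is the sum that the
    machine accumulates with [Isub]. *)
Definition count_diff (s t : seq bool) : nat :=
  sumn [seq p.1 - p.2 | p : bool * bool <- zip s t].

(** Continuation style: the last hypothesis describes the state on leaving the loop, with [k]
    instructions left. Each pass costs 9 instructions and the final test one more. *)
Lemma run_count_diff (x : seq bool) (m : memory) (s t rest rest' : seq bool)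
    (k : nat) (b : bool) :
  m 0 = 1 -> size s = m 4 -> size t = m 4 ->
  drop (m 5) x = s ++ rest -> drop (m 6) x = t ++ rest' ->
  (forall m' : memory, m' 0 = 1 -> m' 4 = 0 -> m' 7 = m 7 + count_diff s t ->
     drop (m' 6) x = rest' -> run difference_program x k 24 m' = Some b) ->
  run difference_program x (9 * m 4 + k.+1) 15 m = Some b.
Proof.
elim: s t m => [|c s IHs] [|c' t] m m0 m4 m4';
  move: (m4'); rewrite -{1}m4 => // _; rewrite -m4.
  move=> _ d6 run_k; rewrite muln0 add0n runS /= -m4.
  by apply: run_k; rewrite // /count_diff addn0.
rewrite !cat_cons => d5 d6 run_k.
have [bE d5'] := input_bit_drop d5; have [bE' d6'] := input_bit_drop d6.
rewrite [size _]/= mulnS -addnA !addSn add0n.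
rewrite runS /= -m4 /=.
do 8 rewrite runS /upd /= ?m0 ?addn1 ?bE ?bE'.
have s4 : size s = m 4 - 1 by rewrite -m4 subn1.
have t4 : size t = m 4 - 1 by rewrite -m4' subn1.
rewrite s4; apply: (IHs t) => //= m' m'0 m'4 m'7 d6''; apply: run_k => //.
by rewrite m'7 /count_diff /= addnA.
Qed.

Lemma run_square (x : seq bool) (m : memory) (k : nat) (b : bool) :
  m 0 = 1 ->
  (forall m' : memory, m' 0 = 1 -> m' 1 = m 1 -> m' 4 = m 4 + m 3 * m 1 ->
     m' 7 = m 7 -> run difference_program x k 10 m' = Some b) ->
  run difference_program x (4 * m 3 + k.+1) 6 m = Some b.
Proof.
move: {2 3 4}(m 3) (erefl (m 3)) => n; elim: n m => [|n IHn] m m3 m0 run_k.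
  by rewrite muln0 add0n runS /= m3; apply: run_k; rewrite ?mul0n ?addn0.
rewrite mulnS -addnA !addSn add0n.
do 4 rewrite runS /upd /= ?m3 ?m0 ?subn1.
apply: IHn => //= m' m'0 m'1 m'4 m'7; apply: run_k => //.
by rewrite m'4 mulSn addnA.
Qed.

Lemma run_unary (x : seq bool) (m : memory) (n k : nat) (rest : seq bool)
    (b : bool) :
  m 0 = 1 -> drop (m 1) x = nseq n true ++ false :: rest ->
  (forall m' : memory, m' 0 = 1 -> m' 1 = m 1 + n -> m' 4 = m 4 ->
     m' 7 = m 7 -> m' 9 = m 9 -> run difference_program x k 5 m' = Some b) ->
  run difference_program x (4 * n + k.+2) 1 m = Some b.
Proof.
elim: n m => [|n IHn] m m0 d1 run_k; have [bE d1'] := input_bit_drop d1.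
  rewrite muln0 add0n; do 2 rewrite runS /upd /= ?bE.
  by apply: run_k; rewrite //= addn0.
rewrite mulnS -addnA !addSn add0n.
do 4 rewrite runS /upd /= ?m0 ?bE ?addn1.
apply: IHn => //= m' m'0 m'1 m'4 m'7 m'9; apply: run_k => //.
by rewrite m'1 addSnnS.
Qed.

Lemma difference_program_correct (n : nat) (A VS S VT T ds : seq bool)
    (neg : bool) :
  size A = n * n -> size VS = n -> size S = n * n -> size VT = n ->
  size T = n * n ->
  let x := nseq n true ++ false :: A ++ (VS ++ S) ++ (VT ++ T) ++ neg :: ds in
  answers_within difference_program x (8 * size x + 22)
    (~~ neg && (count_diff S T <= binary_value ds)).
Proof.
move=> sA sVS sS sVT sT x; rewrite /answers_within.
have sx : size x = n + (n * n + (n + n * n + (n + n * n + (size ds).+1))).+1.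
  by rewrite /x !(size_cat, size_nseq) /= !(size_cat, sA, sVS, sS, sVT, sT) /=.
(* The budget nests as the program does: each product pays for a loop, and the added constants pay
   for exit tests and straight-line code. *)
apply: (@run_monotone _ _ _
  (4 * n + (4 * n + (9 * (n * n) + (8 * (size ds).+1).+4).+4.+2).+3).+1).
  rewrite sx; lia.
(* This offset and the next are the initial values of registers 5 and 6. *)
have xS : drop (n + n + 1 + n * n) x = S ++ (VT ++ T) ++ neg :: ds.
  rewrite (_ : x = (nseq n true ++ false :: A ++ VS) ++ S ++ (VT ++ T) ++ neg :: ds).
    by rewrite drop_size_cat // size_cat size_nseq /= size_cat sA sVS; lia.
  by rewrite /x -!(catA, cat_cons).
have xT : drop (n + n + 1 + n * n + n * n + n) x = T ++ neg :: ds.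
  rewrite (_ : x = (nseq n true ++ false :: A ++ VS ++ S ++ VT) ++ T ++ neg :: ds).
    rewrite drop_size_cat // size_cat size_nseq /= !size_cat sA sVS sS sVT; lia.
  by rewrite /x -!(catA, cat_cons).
have x0 : drop 0 x = nseq n true ++ false :: A ++ (VS ++ S) ++ (VT ++ T) ++ neg :: ds.
  by rewrite drop0.
clearbody x.
rewrite runS /= /upd /=; apply: run_unary => [//||]; first exact: x0.
move=> m /= m0; rewrite add0n => m1 m4 m7 m9.
rewrite runS /upd /= m1 m9 addn0.
have nE : n = upd m 3 n 3 by [].
rewrite {2}nE; apply: run_square; rewrite /upd //= m1 m4 m7 add0n.
move=> {m m0 m1 m4 m7 m9 nE} m m0 m1 m4 m7.
do 5 rewrite runS /upd /= ?m0 ?m1 ?m4.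
rewrite -{1}m4.
apply: (run_count_diff (s := S) (t := T) (rest' := neg :: ds)) => //=.
- by rewrite sS m4.
- by rewrite sT m4.
- exact: xS.
rewrite m7 => {m m0 m1 m4 m7} m m0 m4 m7 d6.
have [negE d6'] := input_bit_drop d6.
do 2 rewrite runS /upd /= ?negE.
case: neg {x0 xS xT d6} negE => _ /=; first by rewrite runS.
rewrite runS /upd /=.
by rewrite (run_digits (s := ds)) //= m4 m7 add0n mul1n.
Qed.

(** * Encoded instances and the polynomial bound *)

(** With one common list of pairs, two zipped encodings merge into a single map. *)
Lemma encode_arcsE (n : nat) (A : {set 'I_n * 'I_n}) :
  encode_arcs A =
    [seq p \in A | p <- [seq (i, j) | i <- enum 'I_n, j <- enum 'I_n]].
Proof. by rewrite map_allpairs. Qed.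

Lemma size_encode_arcs (n : nat) (A : {set 'I_n * 'I_n}) :
  size (encode_arcs A) = n * n.
Proof. by rewrite size_allpairs size_enum_ord. Qed.

Lemma size_encode_verts (n : nat) (S : {set 'I_n}) : size (encode_verts S) = n.
Proof. by rewrite size_map size_enum_ord. Qed.

Lemma count_diff_encode_arcs (n : nat) (A B : {set 'I_n * 'I_n}) :
  count_diff (encode_arcs A) (encode_arcs B) = #|A :\: B|.
Proof.
rewrite /count_diff !encode_arcsE zip_map -map_comp sumnE big_map.
rewrite big_allpairs big_enum; under eq_bigr do rewrite big_enum.
rewrite pair_big /= -sum1_card [RHS]big_mkcond /=.
by apply: eq_bigr => -[i j] _; rewrite inE /=; do 2 case: (_ \in _).
Qed.

Theorem theorem2 :
  poly_time_solvable encode_instance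
    (fun I : instance => valid_instance I /\ spanning_instance I)
    shortest_directed_tree_reconfiguration.
Proof.
exists difference_program, (Poly [:: 22; 8]) => I [_ spanI].
set d := #|arcs (source I) :\: arcs (target I)|.
(* The program rejects a negative bound at its sign bit, so the digits are compared only when they
   represent the bound itself. *)
exists (~~ (max_steps I < 0)%R && (d <= `|max_steps I|)); split.
  have := difference_program_correct (binary `|max_steps I|) (max_steps I < 0)%R
    (size_encode_arcs (graph_arcs I)) (size_encode_verts (verts (source I)))
    (size_encode_arcs (arcs (source I))) (size_encode_verts (verts (target I)))
    (size_encode_arcs (arcs (target I))).
  rewrite count_diff_encode_arcs binaryK horner_Poly /=.
  by apply: run_monotone; rewrite -/(encode_instance I); lia.
rewrite shortest_reconfigurationE // -/d; move: (max_steps I) => z; lia.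
Qed.
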